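(* Let $A=\{a,b\}$. For each integer $\kappa\ge 2$ let $A_\kappa$ be the set of words in $A^*$ with at most $\kappa$ occurrences of any letter, and let $B_\kappa=A_\kappa\cup\{a^\kappa b^\kappa ab\}$. Then $$V(M(A_2))\subset V(M(B_2))\subset V(M(A_3))\subset V(M(B_3))\subset\cdots$$ is a (strictly) ascending chain of varieties alternating between finitely related and non-finitely related: for every $\kappa\ge 2$, the variety $V(M(A_\kappa))$ is finitely related and the variety $V(M(B_\kappa))$ is non-finitely related.
   Context: An operation $f:A^n\to A$ preserves a relation $R\subseteq A^k$ if $f(r_1,\dots,r_n)\in R$ for all $r_1,\dots,r_n\in R$, with $f$ applied coordinatewise. An algebra $\mathbf{A}$ with universe $A$ is finitely related if there is a finite set of finitary relations on $A$ such that the finitary operations on $A$ preserving all of those relations are precisely the term functions of $\mathbf{A}$; otherwise it is non-finitely related. Semigroups and monoids are regarded as algebras with a single binary operation; the $n$-ary term functions are those induced by words in $n$ variables. $V(\mathbf{S})$ denotes the variety generated by $\mathbf{S}$. For finite algebras, being finitely related depends only on the generated variety, so a variety $V(\mathbf{S})$ with $\mathbf{S}$ finite is called finitely related (respectively non-finitely related) if $\mathbf{S}$ is. For a set $W$ of words in the free monoid $A^*$, $M(W)$ is the Rees quotient $A^*/I(W)$, where $I(W)$ is the ideal of all words in $A^*$ that are not subwords (contiguous factors) of words in $W$. Thus the elements of $M(W)$ are $0$ and all subwords (including the empty word, which is the identity) of words in $W$, and $u\cdot v=uv$ if $uv$ is a subword of a word in $W$, and $u\cdot v=0$ otherwise.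 *)

(* Defs.v *)
From HB Require Import structures.
From mathcomp Require Import all_boot.
From mathcomp Require Import boolp classical_sets.

Set Implicit Arguments.
Unset Strict Implicit.
Unset Printing Implicit Defensive.

Import Algebra.
Local Open Scope classical_set_scope.
Local Open Scope group_scope.

Section FinitelyRelated.
Variable S : semigroupType.

Definition preserves (n k : nat) (f : ('I_n -> S) -> S) (R : set ('I_k -> S)) :=
  forall r : 'I_n -> 'I_k -> S,
    (forall i, R (r i)) -> R (fun j => f (fun i => r i j)).

(* The value of the nonempty word i :: w in the variables 'I_n; semigroups have
   no nullary operation, so the empty word does not induce a term function,
   even when S happens to have an identity element. *)
Definition word_eval (n : nat) (i : 'I_n) (w : seq 'I_n) (x : 'I_n -> S) : S :=
  foldl (fun y j => y * x j) (x i) w.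

Definition term_function (n : nat) (f : ('I_n -> S) -> S) :=
  exists i w, forall x, f x = word_eval i w x.

(* Operations have positive arity. Admitting n = 0 would give an equivalent
   notion: every operation of positive arity preserves the empty relation,
   while no nullary one does. *)
Definition finitely_related :=
  exists (m : nat) (k : 'I_m -> nat) (R : forall l, set ('I_(k l) -> S)),
    forall (n : nat) (f : ('I_n -> S) -> S), (0 < n)%N ->
      ((forall l, preserves f (R l)) <-> term_function f).

End FinitelyRelated.

(* P, with the projections p, is a direct product of the family F. *)
Definition is_product (I : Type) (F : I -> semigroupType) (P : semigroupType)
    (p : forall i, {multiplicative P -> F i}) :=
  forall x : (forall i, F i), exists! z : P, forall i, p i z = x i.

(* Classes of semigroups are plain predicates: semigroupType is too large a type
   for classical_sets.set to apply to it. *)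
Definition semigroup_class := semigroupType -> Prop.

Definition strict_subclass (K L : semigroup_class) :=
  (forall S, K S -> L S) /\ (exists S, L S /\ ~ K S).

Record is_variety (K : semigroup_class) : Prop := IsVariety {
  variety_image : forall (S T : semigroupType) (f : {multiplicative S -> T}),
    (forall y, exists x, f x = y) -> K S -> K T ;
  variety_sub : forall (S T : semigroupType) (f : {multiplicative S -> T}),
    injective f -> K T -> K S ;
  variety_prod : forall (I : Type) (F : I -> semigroupType) (P : semigroupType)
      (p : forall i, {multiplicative P -> F i}),
    is_product p -> (forall i, K (F i)) -> K P }.

Definition variety_of (S : semigroupType) : semigroup_class :=
  fun T => forall K, is_variety K -> K S -> K T.

Section WordMonoid.
Variables (X : choiceType) (W : set (seq X)).

Definition subword : pred (seq X) :=
  fun u => `[< exists2 w, W w & infix u w >].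

(* The Rees quotient M(W): None is 0, Some u is the subword u. *)
Definition rees_words : Type := option {u : seq X | subword u}.
HB.instance Definition _ := Choice.on rees_words.

Definition rees_mul (x y : rees_words) : rees_words :=
  match x, y with
  | Some u, Some v => insub (val u ++ val v)
  | _, _ => None
  end.

Lemma subword_infix u v : infix u v -> subword v -> subword u.
Proof.
move=> uv /asboolP[w Ww vw]; apply/asboolP; exists w => //.
exact: infix_trans uv vw.
Qed.

Lemma rees_mulA : associative rees_mul.
Proof.
move=> [u|] [v|] [w|] //=; last by case: insubP.
case: (insubP _ (val v ++ val w)) => [vw _ Evw|nvw];
case: (insubP _ (val u ++ val v)) => [uv _ Euv|nuv] //=.
- by rewrite Euv Evw catA.
- rewrite Evw insubN // catA; apply: contra nuv.
  by apply: subword_infix; exact: prefix_infix.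
- rewrite Euv insubN // -catA; apply: contra nvw.
  by apply: subword_infix; exact: suffix_infix.
Qed.

HB.instance Definition _ := isSemigroup.Build rees_words rees_mulA.

End WordMonoid.

(* The two-letter alphabet is bool. *)
Definition letter_a : bool := false.
Definition letter_b : bool := true.

Definition words_A (k : nat) : set (seq bool) :=
  [set w | forall c : bool, (count_mem c w <= k)%N].

Definition words_B (k : nat) : set (seq bool) :=
  words_A k `|`
  [set nseq k letter_a ++ nseq k letter_b ++ [:: letter_a; letter_b]].

Definition M_A (k : nat) : semigroupType := rees_words (words_A k).
Definition M_B (k : nat) : semigroupType := rees_words (words_B k).

(* Main.v *)
Require Import Defs.
From HB Require Import structures.
From mathcomp Require Import all_boot zify.
From mathcomp Require Import boolp classical_sets.

Set Implicit Arguments.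
Unset Strict Implicit.
Unset Printing Implicit Defensive.

Import Algebra.
Local Open Scope nat_scope.

(** The elements of M(W) are the classes of words, all words that are not
    subwords of W being identified to 0.  Evaluating the word w at the classes
    of the words g i gives the class of the word obtained from w by the
    substitution g ([word_eval_rees_class]), so every question below asks
    whether, and as which word, a substituted word survives.

    Inclusions.  M(W) is a quotient of M(W') as soon as W consists of subwords
    of W', which gives both inclusions.  They are strict because of identities.
    x^k y^k xy = x^k y^k yx holds in M(A_k), where nontrivial values of x and y
    send both sides to 0, and fails in M(B_k) by construction of B_k.
    x^(k+1) = x^(k+2) holds in M(B_k), where no nontrivial (k+1)-st power
    survives ([power_not_subword_B]), and fails in M(A_(k+1)) at x = a.

    M(B_k) is not finitely related.  If n exceeds the number of K-tuples of
    elements, then among n members of a K-ary relation two coincide; hence an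
    n-ary f preserves the relations that the terms preserve as soon as each of
    its restrictions to x_i = x_j is a term ([not_finitely_related]).  Letters
    that occur k+1 times in a word interact in M(B_k) only through the pairs
    x, y with restriction x^k y^k xy.  Let f ([cyclic_op]) be the operation for
    which these pairs are the arcs of a directed cycle through all n variables.
    No word induces f, because its first letter x_i would have to come after
    its predecessor on the cycle.  But when x_i = x_j, the operation f vanishes
    unless x_i = 1; this cuts the cycle open into a path y_1, ..., y_m, which
    is realised by the word y_1^k y_2^k y_1 y_3^k y_2 ... y_m^k y_(m-1) y_m.

    M(A_k) is finitely related.  A single relation suffices: the N-ary term
    functions, seen as tuples of values, with N large.  For an operation f
    preserving it, identifying the variables of f in any way that leaves at
    most N of them gives a term.  Over M(A_k) a word matters only through its
    numbers of occurrences, capped at k+1, and the relative order of the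
    letters that occur at most k times, and this order is determined by pairs
    of letters ([eq_rees_class_A]).  Setting all variables but two to 1 thus
    yields a word in two letters for each pair, setting all but three to 1
    shows that these words are consistent, and consistent pairs glue to one
    word u ([amalgamation]) that agrees with f whenever at most two variables
    are not 1.  To compare f and u at an arbitrary point, keep a bounded number
    of variables separate and identify the others according to their values
    ([localize]): either few variables of u have a value other than 1, and all
    of them can be kept, or both f and u vanish already because of the
    variables that are kept. *)

Local Notation a := false.
Local Notation b := true.

(** * Substitution in words *)

Local Notation subst g w := (flatten [seq g i | i <- w]).

Definition power (T : Type) n (u : seq T) := flatten (nseq n u).

Lemma size_power (T : Type) n (u : seq T) : size (power n u) = n * size u.
Proof. by elim: n => //= n IH; rewrite size_cat IH. Qed.

Lemma count_power (T : Type) p n (u : seq T) : count p (power n u) = n * count p u.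
Proof. by elim: n => //= n IH; rewrite count_cat IH. Qed.

Lemma power1 (T : Type) n (c : T) : power n [:: c] = nseq n c.
Proof. by elim: n => //= n <-. Qed.

Lemma power_nil (T : Type) n : power n ([::] : seq T) = [::].
Proof. by elim: n. Qed.

Lemma subst_nseq (T U : Type) (g : T -> seq U) n i :
  subst g (nseq n i) = power n (g i).
Proof. by rewrite map_nseq. Qed.

Lemma subst_nseqS (T U : Type) (g : T -> seq U) n i :
  subst g (i :: nseq n i) = power n.+1 (g i).
Proof. by rewrite -subst_nseq. Qed.

Lemma subst_cat (T U : Type) (g : T -> seq U) u v :
  subst g (u ++ v) = subst g u ++ subst g v.
Proof. by rewrite map_cat flatten_cat. Qed.

Lemma subst_nil (T : eqType) (U : Type) (g : T -> seq U) w :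
  subst g w = [::] <-> forall i, i \in w -> g i = [::].
Proof.
elim: w => [|i w IH] //=; split.
  case gi: (g i) => //= /IH gw j; rewrite inE => /orP[/eqP->|/gw] //.
move=> gw; rewrite gw ?mem_head //; apply/IH => j jw.
by apply: gw; rewrite inE jw orbT.
Qed.

Lemma subst_filter (T : eqType) (U : eqType) (g : T -> seq U) w :
  subst g [seq i <- w | g i != [::]] = subst g w.
Proof. by elim: w => //= i w IH; case: eqP => [->|_] //=; rewrite IH. Qed.

Lemma count_subst_ge (T : eqType) (g : T -> seq bool) c i w :
  count_mem i w * count_mem c (g i) <= count_mem c (subst g w).
Proof.
elim: w => //= j w IH; rewrite count_cat mulnDl leq_add //.
by case: eqP => [->|_]; rewrite ?mul1n ?mul0n.
Qed.

Lemma size_subst_ge (T : eqType) (U : eqType) (g : T -> seq U) (D w : seq T) :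
  uniq D -> (forall i, i \in D -> i \in w /\ g i != [::]) -> size D <= size (subst g w).
Proof.
move=> uD DP; apply: leq_trans (_ : size [seq i <- w | g i != [::]] <= _).
  by apply: uniq_leq_size => // i /DP[iw gi]; rewrite mem_filter gi.
elim: w {DP} => //= i w IH; rewrite size_cat; case: eqP => [->|] //=.
by case: (g i) => //= *; lia.
Qed.

Definition delta (T : eqType) (i : T) (c : bool) : T -> seq bool :=
  fun j => if j == i then [:: c] else [::].

Lemma subst_delta (T : eqType) (i : T) c w :
  subst (delta i c) w = nseq (count_mem i w) c.
Proof. by elim: w => //= j w ->; rewrite /delta; case: eqP. Qed.

Lemma size_count_bool (u : seq bool) : size u = count_mem a u + count_mem b u.
Proof. by elim: u => [|[] u /= ->] //=; rewrite ?addnS ?addSn. Qed.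

Lemma infix_nth (T : eqType) (x0 : T) (u v : seq T) : infix u v ->
  exists2 m, m + size u <= size v & forall i, i < size u -> nth x0 v (m + i) = nth x0 u i.
Proof.
case/infixP=> p [s ->]; exists (size p) => [|i iu]; first by rewrite !size_cat; lia.
by rewrite nth_cat ltnNge leq_addr addKn /= nth_cat iu.
Qed.

Lemma infix_eq_size (T : eqType) (u v : seq T) : infix u v -> size v <= size u -> u = v.
Proof.
case/infixP => p [s ->]; rewrite !size_cat => sz.
have [/size0nil -> /size0nil ->] : size p = 0 /\ size s = 0 by lia.
by rewrite cats0.
Qed.

(** * Words determined by their restrictions to pairs of letters *)

Lemma filter_pred2_diag (T : eqType) (i : T) w :
  filter (pred2 i i) w = nseq (count_mem i w) i.
Proof. by elim: w => //= j w ->; case: eqP => [->|] //=. Qed.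

Lemma filter_pred2_filter (T : eqType) (P : pred T) i j (w : seq T) :
  filter (pred2 i j) (filter P w) =
  if P i then if P j then filter (pred2 i j) w else filter (pred2 i i) w
  else if P j then filter (pred2 j j) w else [::].
Proof.
have PE l m : (l == m) ==> (P l == P m) by apply/implyP => /eqP->.
rewrite -filter_predI; case Pi: (P i); case Pj: (P j);
  [| | |rewrite -(filter_pred0 w)]; apply: eq_filter => l /=;
  move: (PE l i) (PE l j); rewrite Pi Pj;
  by case: (l == i); case: (l == j); case: (P l).
Qed.

(** The first letter of a word is recognised by comparing it with each other
    letter. *)
Lemma eq_from_pairs (T : eqType) (w v : seq T) :
  (forall i j, filter (pred2 i j) w = filter (pred2 i j) v) -> w = v.
Proof.
elim: w v => [|t w IH] [|s v] //= E.
- by have := E s s; rewrite /= eqxx.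
- by have := E t t; rewrite /= eqxx.
have ts : t = s by have := E t s; rewrite /= !eqxx orbT => -[].
by rewrite -ts in E *; congr cons; apply: IH => i j; have := E i j; case: ifP => // _ [].
Qed.

Lemma eq_filter_from_pairs (T : eqType) (P : pred T) (w v : seq T) :
  (forall i j, P i -> P j -> filter (pred2 i j) w = filter (pred2 i j) v) ->
  filter P w = filter P v.
Proof.
move=> E; apply: eq_from_pairs => i j; rewrite !filter_pred2_filter.
by case: ifP => Pi; case: ifP => Pj //; rewrite E.
Qed.

Lemma filter_rem (T : eqType) (P : pred T) (t : T) w :
  filter P (rem t w) = rem t (filter P w).
Proof.
elim: w => //= l w IH; case: (eqVneq l t) => [->|lt] /=.
  case: ifP => Pt /=; first by rewrite eqxx.
  by rewrite rem_id // mem_filter Pt.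
by rewrite (fun_if (rem t)) /= (negbTE lt) IH.
Qed.

Section Amalgamation.
Variable T : eqType.
Implicit Types p : T -> T -> seq T.

(** The words p r s, one for each pair of letters, agree on every three
    letters; this also forces p r s to be a word in r and s only. *)
Definition consistent p :=
  forall r s t, exists w, [/\ filter (pred2 r s) w = p r s,
     filter (pred2 s t) w = p s t & filter (pred2 r t) w = p r t].

Lemma consistent_sym p r s : consistent p -> p r s = p s r.
Proof.
by move=> /(_ r s r)[w [<- <- _]]; apply: eq_filter => l /=; rewrite orbC.
Qed.

Lemma consistent_head_trans p r s t : consistent p ->
  ohead (p r s) = Some r -> ohead (p s t) = Some s -> ohead (p r t) = Some r.
Proof.
move=> /(_ r s t)[w [<- <- <-]]; elim: w => //= l w IH.
case: (eqVneq l r) => [->|lr] //=; case: (eqVneq l s) => [ls|ls] //=.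
  by move=> [E] _; rewrite E eqxx in lr.
by case: (eqVneq l t) => [lt|lt] //= _ [ts]; rewrite ts eqxx in ls.
Qed.

Lemma consistent_head p r s : consistent p -> p r r != [::] ->
  ohead (p r s) = Some r \/ ohead (p s r) = Some s.
Proof.
move=> cp; rewrite -(consistent_sym r s cp); have [w [<- _ <-]] := cp r s r.
elim: w => //= l w IH.
by case: (eqVneq l r) => [->|_] /=; [left|case: (eqVneq l s) => [->|_] /=; [right|]].
Qed.

Lemma consistent_head_live p r s : consistent p ->
  ohead (p r s) = Some r -> p r r != [::].
Proof.
move=> /(_ r s r)[w [<- _ <-]]; elim: w => //= l w IH.
by case: (eqVneq l r) => [->|lr] //=; case: (l == s) => //= -[E]; rewrite E eqxx in lr.
Qed.

(** Among the letters that occur, the one that the glued word must start with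
    exists because the relation of coming first is total and transitive. *)
Lemma consistent_first p (l : seq T) t : consistent p -> t \in l -> p t t != [::] ->
  exists t', forall s, s \in t' :: l -> ohead (p t' s) = Some t'.
Proof.
move=> cp tl t0; suff [t' tt' H] : exists2 t', ohead (p t' t) = Some t' &
    forall s, s \in l -> ohead (p t' s) = Some t'.
  exists t' => s; rewrite inE => /orP[/eqP->|/H//].
  by have [] := consistent_head t' cp (consistent_head_live cp tt').
elim: l {tl} => [|r l [t' tt' IH]].
  by exists t => //; have [] := consistent_head t cp t0.
have live := consistent_head_live cp tt'.
have [E|E] := consistent_head r cp live.
  by exists t' => // s; rewrite inE => /orP[/eqP->|/IH].
exists r => [|s]; first exact: consistent_head_trans E tt'.
rewrite inE => /orP[/eqP->|/IH]; last exact: consistent_head_trans E.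
by have [] := consistent_head r cp (consistent_head_live cp E).
Qed.

Lemma consistent_rem p t : consistent p -> consistent (fun r s => rem t (p r s)).
Proof.
by move=> cp r s q; have [w [<- <- <-]] := cp r s q; exists (rem t w); rewrite !filter_rem.
Qed.

End Amalgamation.

(** Three letters are enough: orders on the set of all occurrences are given by
    comparing pairs, and transitivity involves only triples.  The glued word is
    built letter by letter, removing its first letter from all the p r s. *)
Lemma amalgamation (T : finType) (p : T -> T -> seq T) : consistent p ->
  exists u, forall r s, filter (pred2 r s) u = p r s.
Proof.
have [m] := ubnP (\sum_t size (p t t)); elim: m p => // m IH p pm cp.
have [/forallP dead|/forallPn[t t0]] := boolP [forall t, p t t == [::]].
  (* no letter occurs, so every p r s is empty *)
  exists [::] => r s; case E: (p r s) => [|l u] //.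
  have [w [wrs _ wrr]] := cp r s r; have [w' [ws'r _ ws's]] := cp s r s.
  have /eqP := dead r; have /eqP := dead s; rewrite -wrr -ws's.
  have : l \in p r s by rewrite E mem_head.
  rewrite -{1}wrs mem_filter => /andP[/= /orP[/eqP lr|/eqP ls] lw].
    by move=> _ Er; have := mem_filter (pred2 r r) l w; rewrite Er /= lr eqxx -lr lw.
  have : l \in p s r by rewrite (consistent_sym _ _ cp) E mem_head.
  rewrite -{1}ws'r mem_filter => /andP[_ lw'].
  by move=> Es; have := mem_filter (pred2 s s) l w'; rewrite Es /= ls eqxx -ls lw'.
have [t' tmin] := consistent_first cp (mem_enum T t) t0.
have {}tmin s : p t' s = t' :: behead (p t' s).
  by have := tmin s; rewrite inE mem_enum orbT; case: (p t' s) => [|l u] /(_ isT) //= [->].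
have [|u uP] := IH _ _ (consistent_rem t' cp).
  apply: leq_trans (pm : \sum_t size (p t t) <= m); rewrite (bigD1 t') //= [X in _ <= X](bigD1 t') //=.
  rewrite -addSn leq_add //.
    by rewrite tmin /= eqxx.
  by apply: leq_sum => s _; exact: size_subseq (rem_subseq _ _).
have head s : t' :: rem t' (p t' s) = p t' s by rewrite tmin /= eqxx.
exists (t' :: u) => r s /=; rewrite uP; case: eqP => [<-|/eqP tr] /=; first exact: head.
case: eqP => [<-|/eqP ts]; first by rewrite (consistent_sym r t' cp) head.
have [w [<- _ _]] := cp r s r.
by rewrite rem_id // mem_filter /= (negbTE tr) (negbTE ts).
Qed.

(** * Rees quotients and their term functions *)

Definition rees_class (X : choiceType) (W : set (seq X)) (u : seq X) : rees_words W := insub u.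

Lemma rees_classM (X : choiceType) (W : set (seq X)) u v :
  rees_class W (u ++ v) = (rees_class W u * rees_class W v)%g.
Proof.
rewrite /rees_class /mul /= /rees_mul.
case: (insubP _ u) => [u' _ <-|nu] /=; first last.
  rewrite insubN //; apply: contra nu; apply: subword_infix; exact: prefix_infix.
case: (insubP _ v) => [v' _ <-|nv] //=.
rewrite insubN //; apply: contra nv; apply: subword_infix; exact: suffix_infix.
Qed.

Lemma rees_class_zero (X : choiceType) (W : set (seq X)) u :
  ~~ subword W u -> rees_class W u = None.
Proof. by move=> nu; rewrite /rees_class insubN. Qed.

Lemma rees_class_inj (X : choiceType) (W : set (seq X)) u v :
  subword W u -> rees_class W u = rees_class W v -> u = v.
Proof.
rewrite /rees_class => su; rewrite (insubT _ su); case: insubP => // v' _ <- [E].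
by rewrite -E.
Qed.

Lemma rees_class_surj (X : choiceType) (W : set (seq X)) z :
  ~~ subword W z -> forall s, exists u, rees_class W u = s.
Proof.
move=> nz [[u su]|]; last by exists z; exact: rees_class_zero.
by exists u; rewrite /rees_class insubT.
Qed.

Lemma rees_finite (W : set (seq bool)) L :
  (forall u, subword W u -> size u <= L) ->
  exists s : seq (rees_words W), forall x, x \in s.
Proof.
move=> sz; pose short := iter L (fun s => [::] :: [seq c :: u | c <- [:: false; true], u <- s]) [:: [::]].
have shortP u : size u <= L -> u \in short.
  rewrite /short; elim: (L) u {sz short} => [|m IH] [|c u] //= um.
  by rewrite inE /= cats0 mem_cat; case: c; rewrite (map_f (cons _)) ?orbT ?IH.
exists (None :: map (rees_class W) short) => -[[u su]|]; last exact: mem_head.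
rewrite inE /=; apply/mapP; exists u; first exact: shortP (sz _ su).
by rewrite /rees_class insubT.
Qed.

Lemma word_eval_rees_class (X : choiceType) (W : set (seq X)) n (g : 'I_n -> seq X) i w :
  word_eval i w (fun j => rees_class W (g j)) = rees_class W (subst g (i :: w)).
Proof.
rewrite /word_eval /=; elim: w (g i) => [|j w IH] u /=; first by rewrite cats0.
by rewrite -rees_classM IH catA.
Qed.

Lemma word_eval_cat (S : semigroupType) n (x : 'I_n -> S) i w j v :
  word_eval i (w ++ j :: v) x = (word_eval i w x * word_eval j v x)%g.
Proof.
rewrite /word_eval foldl_cat /=; move: (foldl _ _ w) => s.
by elim: v (x j) => [|l v IH] t //=; rewrite -mulgA IH.
Qed.

Lemma word_eval_morph (S T : semigroupType) (f : {multiplicative S -> T}) n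
    (x : 'I_n -> S) i w :
  f (word_eval i w x) = word_eval i w (fun j => f (x j)).
Proof.
rewrite /word_eval; elim: w (x i) => [|j w IH] s //=.
by rewrite IH gmulfM.
Qed.

Lemma word_eval_comp (S : semigroupType) n m (i : 'I_n) w
    (p : 'I_n -> 'I_m) (q : 'I_n -> seq 'I_m) :
  exists i' w', forall x : 'I_m -> S,
    word_eval i w (fun j => word_eval (p j) (q j) x) = word_eval i' w' x.
Proof.
elim/last_ind: w => [|w j [i' [w' E]]]; first by exists (p i), (q i).
exists i', (w' ++ p j :: q j) => x.
by rewrite word_eval_cat -E /word_eval foldl_rcons.
Qed.

Section Quotient.
Variables (X : choiceType) (W W' : set (seq X)) (z : seq X).
Hypothesis subWW' : forall u, W u -> subword W' u.
Hypothesis nz : ~~ subword W z.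

Lemma subword_mono u : subword W u -> subword W' u.
Proof. by case/asboolP=> w Ww uw; exact: subword_infix uw (subWW' Ww). Qed.

Definition rees_quot (s : rees_words W') : rees_words W :=
  if s is Some u then rees_class W (val u) else None.

Lemma rees_quot_class u : rees_quot (rees_class W' u) = rees_class W u.
Proof.
rewrite {1}/rees_class; case: insubP => [u' _ <-|nu] //=.
by rewrite rees_class_zero //; apply: contra nu; exact: subword_mono.
Qed.

Lemma rees_quotM : {morph rees_quot : s t / (s * t)%g}.
Proof.
move=> [u|] [v|] //=; last by rewrite /mul /= /rees_mul; case: (rees_class _ _).
by rewrite {1}/mul /= -/(rees_class W' _) rees_quot_class rees_classM.
Qed.

HB.instance Definition _ := isMultiplicative.Build _ _ rees_quot rees_quotM.

(** The word z, absent from W, provides the preimage of 0. *)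
Lemma rees_quot_variety T :
  variety_of (rees_words W) T -> variety_of (rees_words W') T.
Proof.
move=> VT K varK KW'; apply: (VT _ varK); apply: (variety_image varK (f := rees_quot)) KW'.
move=> s; have [u <-] := rees_class_surj nz s.
by exists (rees_class W' u); exact: rees_quot_class.
Qed.

End Quotient.

(** * Identities *)

Definition models n (i : 'I_n) w j v : semigroup_class :=
  fun S => forall x : 'I_n -> S, word_eval i w x = word_eval j v x.

Lemma models_variety n (i : 'I_n) w j v : is_variety (models i w j v).
Proof.
split=> [S T f fsurj KS x|S T f finj KT x|I F P p prodP KF x].
- have [y fy] := choice (fun l => fsurj (x l)).
  have -> : x = fun l => f (y l) by apply: funext => l; rewrite fy.
  by rewrite -!word_eval_morph KS.
- by apply: finj; rewrite !word_eval_morph KT.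
(* both sides are the only element with the projections of the first one *)
have [z [_ zuniq]] := prodP (fun l => p l (word_eval i w x)).
rewrite -(zuniq _ (fun=> erefl)); apply: zuniq => l.
by rewrite !word_eval_morph KF.
Qed.

Lemma variety_of_models (S T : semigroupType) n (i : 'I_n) w j v :
  models i w j v S -> variety_of S T -> models i w j v T.
Proof. by move=> MS /(_ _ (models_variety i w j v) MS). Qed.

Lemma models_rees (X : choiceType) (W : set (seq X)) z n (i : 'I_n) w j v :
  ~~ subword W z ->
  models i w j v (rees_words W) <->
  forall g, rees_class W (subst g (i :: w)) = rees_class W (subst g (j :: v)).
Proof.
move=> nz; split=> [M g|E x]; first by rewrite -!word_eval_rees_class M.
have [g gx] := choice (fun l => rees_class_surj nz (x l)).
have -> : x = fun l => rees_class W (g l) by apply: funext => l; rewrite gx.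
by rewrite !word_eval_rees_class E.
Qed.

(** * The words that survive in M(A_k) and M(B_k) *)

Definition square_word k : seq bool := nseq k a ++ nseq k b ++ [:: a; b].

Lemma subword_AP k (u : seq bool) : reflect (words_A k u) (subword (words_A k) u).
Proof.
apply: (iffP (asboolP _)) => [[w Ww uw] c|Wu]; last by exists u => //; exact: infix_refl.
apply: leq_trans (Ww c); have /infixP[p [s ->]] := uw.
by rewrite !count_cat; lia.
Qed.

Lemma subword_BP k (u : seq bool) :
  reflect (words_A k u \/ infix u (square_word k)) (subword (words_B k) u).
Proof.
apply: (iffP (asboolP _)) => [[w [Ww|->] uw]|]; last first.
- by case=> [Wu|uz]; [exists u; [left|exact: infix_refl]|exists (square_word k); [right|]].
- by right.
by left; apply/subword_AP/asboolP; exists w.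
Qed.

Lemma size_square_word k : size (square_word k) = k.*2.+2.
Proof. by rewrite !size_cat !size_nseq /=; lia. Qed.

Lemma count_square_word k c : count_mem c (square_word k) = k.+1.
Proof. by rewrite !count_cat !count_nseq; case: c => /=; lia. Qed.

Lemma nth_square_word k i : nth a (square_word k) i = (k <= i < k.*2) || (i == k.*2.+1).
Proof.
rewrite !nth_cat !nth_nseq !size_nseq -addnn.
case: ltnP => ik; first by case: eqP => //; lia.
case: ltnP => i2k; first by rewrite (_ : i < k + k) //=; lia.
rewrite (_ : i < k + k = false) /=; last by lia.
case E: (i - k - k) => [|[|m]] /=; symmetry; apply/eqP; try lia.
by rewrite nth_nil; lia.
Qed.

Lemma subword_B_count k (u : seq bool) (c : bool) :
  subword (words_B k) u -> count_mem c u <= k.+1.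
Proof.
case/subword_BP => [/(_ c) |/infixP[p [s E]]]; first exact: leqW.
by rewrite -(count_square_word k c) E !count_cat; lia.
Qed.

Lemma subword_B_short k (u : seq bool) : size u <= k -> subword (words_B k) u.
Proof.
by move=> uk; apply/subword_BP; left => c; apply: leq_trans (count_size _ _) uk.
Qed.

Lemma square_wordB k : subword (words_B k) (square_word k).
Proof. by apply/subword_BP; right; exact: infix_refl. Qed.

Lemma power_not_subword_A k (u : seq bool) : u != [::] ->
  ~~ subword (words_A k) (power k.+1 u).
Proof.
case: u => // c u _; apply/negP => /subword_AP/(_ c).
by rewrite count_power /= eqxx; lia.
Qed.

Lemma letter_power_not_infix k c : 2 <= k -> ~~ infix (nseq k.+1 c) (square_word k).
Proof.
move=> k2; apply/negP => /(infix_nth a)[m]; rewrite size_square_word size_nseq => mk E.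
have {}E i : i <= k -> ((k <= m + i < k.*2) || (m + i == k.*2.+1)) = c.
  by move=> ik; rewrite -nth_square_word E // nth_nseq ltnS ik.
(* wherever it starts, a factor of length k+1 has a letter other than c: its
   first letter, or the letter number k, 2k or 2k+1 of the whole word *)
case: c E => E.
  have [mk'|mk'] := ltnP m k; first by have := E 0; lia.
  by have := E (k.*2 - m); lia.
have [mk'|mk'] := leqP m k; first by have := E (k - m); lia.
by have := E k; lia.
Qed.

(** Hence a variable that occurs k+1 times in a row can only take the value 1.
    Only powers of words u of length 1 or 2 fit into a^k b^k ab, which has no
    factor c^(k+1) and is not periodic of period 2. *)
Lemma power_not_subword_B k (u : seq bool) : 2 <= k -> u != [::] ->
  ~~ subword (words_B k) (power k.+1 u).
Proof.
move=> k2 u0; apply/negP => /subword_BP[].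
  case: u u0 => // c u _ /(_ c); rewrite count_power /= eqxx; lia.
move=> uz; have := size_infix uz; rewrite size_power size_square_word.
case: u uz u0 => [|c [|d u]] // uz _ /=.
  by move=> _; move: uz; rewrite power1 (negbTE (letter_power_not_infix _ k2)).
case: u uz => [|e u] uz /=; last by lia.
(* u has length 2 and its power is the whole word a^k b^k ab, which is not
   periodic: its letters number k-1 and k+1, counted from 0, differ *)
move=> _; have [m ms E] := infix_nth a uz.
have m0 : m = 0 by move: ms; rewrite size_power size_square_word /=; lia.
have nthP n i : i < n * 2 -> nth a (power n [:: c; d]) i = if odd i then d else c.
  elim: n i => [|n IH] [|[|i]] //= ilt; rewrite IH ?negbK //; lia.
case: k k2 {uz ms} E => [|k] //= k1 E.
have Ek j : j < k.+2 * 2 ->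
    (k.+1 <= j < k.+1.*2) || (j == k.+1.*2.+1) = if odd j then d else c.
  by move=> jlt; rewrite -nth_square_word -[j]add0n -{1}m0 E ?nthP ?size_power.
have := Ek k.+2; rewrite /= negbK -Ek; [|lia..]; lia.
Qed.

(** * The strict inclusions *)

Local Notation vx := (ord0 : 'I_2).
Local Notation vy := (ord_max : 'I_2).

Lemma variety_A_strict_B k : 2 <= k ->
  strict_subclass (variety_of (M_A k)) (variety_of (M_B k)).
Proof.
move=> k2; split; first last.
  exists (M_B k); split; first by [].
  (* the identity x^k y^k xy = x^k y^k yx *)
  pose w (u : seq 'I_2) := nseq k.-1 vx ++ nseq k vy ++ u.
  have wE u : vx :: w u = nseq k vx ++ nseq k vy ++ u.
    by rewrite /w -cat_cons; case: (k) k2.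
  move=> VB; have : models vx (w [:: vx; vy]) vx (w [:: vy; vx]) (M_A k).
    apply/(models_rees _ _ _ _ (power_not_subword_A k (isT : [:: a] != [::]))) => g.
    rewrite !wE !subst_cat !subst_nseq /= !cats0.
    have [->|gx0] := eqVneq (g vx) [::]; first by rewrite !cats0.
    have [->|gy0] := eqVneq (g vy) [::]; first by rewrite !cats0.
    rewrite !rees_class_zero //; apply/negP => /subword_AP.
      case: (g vx) gx0 => // c u _ /(_ c).
      by rewrite !count_cat !count_power /= eqxx; nia.
    case: (g vx) gx0 => // c u _ /(_ c).
    by rewrite !count_cat !count_power /= eqxx; nia.
  move/variety_of_models => /(_ _ VB).
  move/(models_rees _ _ _ _ (power_not_subword_B k2 (isT : [:: a] != [::]))).
  move=> /(_ (fun i => [:: i == vy])).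
  rewrite !wE !subst_cat !subst_nseq /=.
  rewrite !power1 => /(rees_class_inj (square_wordB k))/eqP.
  by rewrite !eqseq_cat ?size_nseq //= => /and3P[].
apply: (@rees_quot_variety _ _ _ (power k.+1 [:: a])) => [w Aw|].
  by apply/subword_BP; left.
exact: power_not_subword_A.
Qed.

Lemma variety_B_strict_A k : 2 <= k ->
  strict_subclass (variety_of (M_B k)) (variety_of (M_A k.+1)).
Proof.
move=> k2; split; first last.
  exists (M_A k.+1); split; first by [].
  move=> VA.
  (* the identity x^(k+1) = x^(k+2) *)
  have : models (ord0 : 'I_1) (nseq k ord0) ord0 (nseq k.+1 ord0) (M_B k).
    apply/(models_rees _ _ _ _ (power_not_subword_B k2 (isT : [:: a] != [::]))) => g.
    rewrite !subst_nseqS.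
    have [->|g0] := eqVneq (g ord0) [::].
      by rewrite !power_nil.
    rewrite !rees_class_zero ?power_not_subword_B //.
    apply: contra (power_not_subword_B k2 g0); apply: subword_infix.
    by rewrite /power -[k.+2]addn1 nseqD flatten_cat; exact: prefix_infix.
  move/variety_of_models => /(_ _ VA).
  move/(models_rees _ _ _ _ (power_not_subword_A k.+1 (isT : [:: a] != [::])))=> /(_ (fun=> [:: a])).
  rewrite !subst_nseqS => /rees_class_inj E.
  suff /E/(congr1 size) : subword (words_A k.+1) (power k.+1 [:: a]).
    by rewrite !size_power /=; lia.
  by apply/subword_AP => c; rewrite count_power /=; lia.
apply: (@rees_quot_variety _ _ _ (power k.+1 [:: a])) => [w [Aw|->]|].
- by apply/subword_AP => c; exact: leq_trans (Aw c) _.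
- by apply/subword_AP => c; rewrite count_square_word.
exact: power_not_subword_B.
Qed.

(** * M(B_k) is not finitely related *)

(** By the pigeonhole principle, an operation of large arity preserves the given
    relations as soon as its restrictions to x_i = x_j are terms. *)
Lemma not_finitely_related (S : semigroupType) (s : seq S) :
  (forall x, x \in s) ->
  (forall n, 2 <= n -> exists2 f : ('I_n -> S) -> S, ~ term_function f &
    forall i j, i != j -> exists i0 w0, forall x, x i = x j -> f x = word_eval i0 w0 x) ->
  ~ finitely_related S.
Proof.
move=> sP nonterm [m [K [R RP]]].
pose n := (\sum_(l < m) size s ^ K l).+2.
have [f nf fminor] := nonterm n isT; apply: nf; apply/(RP n f isT) => l r rR.
have sn : size s ^ K l < n by rewrite /n (bigD1 l) //=; lia.
have lt_index i j : index (r i j) s < size s by rewrite index_mem.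
pose h i := [ffun j => Ordinal (lt_index i j)].
case: (boolP (injectiveb h)) => [/injectiveP/leq_card|/injectivePn[i [j ij hij]]].
  by rewrite card_ffun !card_ord leqNgt sn.
have rij : r i = r j.
  apply: funext => t; have /(congr1 (fun z => nth (r i t) s (val z))) := congr1 (fun F : {ffun _ -> _} => F t) hij.
  by rewrite !ffunE /= !nth_index.
have [i0 [w0 fE]] := fminor i j ij.
have -> : (fun t => f (fun i => r i t)) = fun t => word_eval i0 w0 (fun i => r i t).
  by apply: funext => t; apply: fE; rewrite rij.
have wT : term_function (word_eval (S := S) i0 w0) by exists i0, w0.
exact: (RP n _ isT).2 wT l _ rR.
Qed.

(** For s = y_1, ..., y_m, [path_word k s] is
    y_1^k y_2^k y_1 y_3^k y_2 ... y_m^k y_(m-1) y_m: its restriction to two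
    letters y, y' is y^k y'^k y y' if y' comes immediately after y in s, and
    y^(k+1) y'^(k+1) if it comes later. *)
Fixpoint path_tail (T : Type) k (x : T) s :=
  if s is y :: s' then nseq k y ++ x :: path_tail k y s' else [:: x].

Definition path_word (T : Type) k (s : seq T) :=
  if s is x :: s' then nseq k x ++ path_tail k x s' else [::].

Lemma size_path_tail (T U : Type) (g : T -> seq U) k x s :
  size (subst g (path_tail k x s)) = size (g x) + k.+1 * size (subst g s).
Proof.
elim: s x => [|y s IH] x /=; first by rewrite cats0; lia.
rewrite subst_cat subst_nseq /= !size_cat size_power IH; lia.
Qed.

Lemma path_tail_nil (T : eqType) (U : Type) (g : T -> seq U) k x s :
  subst g s = [::] -> subst g (path_tail k x s) = g x.
Proof.
elim: s x => [|y s IH] x /=; first by rewrite cats0.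
case gy: (g y) => //= gs; rewrite subst_cat subst_nseq /= IH // gy cats0.
by rewrite power_nil.
Qed.

Lemma path_word_cons (T U : Type) (g : T -> seq U) k x s : g x = [::] ->
  subst g (path_word k (x :: s)) = subst g (path_word k s).
Proof.
move=> gx; rewrite /path_word.
by case: s => [|y s] /=; rewrite !subst_cat !subst_nseq /= gx power_nil.
Qed.

Lemma path_word_edge (T : eqType) (g : T -> seq bool) k s1 u v s2 :
  subst g s1 = [::] -> subst g s2 = [::] -> g u = [:: a] -> g v = [:: b] ->
  subst g (path_word k (s1 ++ u :: v :: s2)) = square_word k.
Proof.
move=> gs1 gs2 gu gv; elim: s1 gs1 => [_|x s1 IH] /=; last first.
  by case gx: (g x) => //= /IH E; rewrite -E -(path_word_cons _ _ gx).
by rewrite !subst_cat !subst_nseq /= path_tail_nil // gu gv !power1.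
Qed.

(** Each of the letters occurs k+1 times.  Hence the first letter x with a
    nontrivial value forces a subword of a^k b^k ab, whose length leaves room
    for two letters only, and the next letter must have a nontrivial value as
    well, since otherwise the (k+1)-st power of the value of x appears. *)
Lemma path_wordP (T : eqType) (g : T -> seq bool) k s : 2 <= k ->
  subword (words_B k) (subst g (path_word k s)) ->
  subst g s = [::] \/
  exists s1 u v s2, [/\ s = s1 ++ u :: v :: s2, g u = [:: a], g v = [:: b] &
    subst g (s1 ++ s2) = [::]].
Proof.
move=> k2; elim: s => [|x s IH]; first by left.
have [gx|gx0] := eqVneq (g x) [::].
  rewrite path_word_cons // => /IH [E|[s1 [u [v [s2 [-> gu gv gs]]]]]].
    by left; rewrite /= gx.
  by right; exists (x :: s1), u, v, s2; rewrite /= gx.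
case: s {IH} => [|y s].
  rewrite /path_word /= (_ : nseq k x ++ [:: x] = nseq k.+1 x).
    by rewrite subst_nseq (negbTE (power_not_subword_B _ _)).
  by rewrite -(nseqD k 1) addn1.
rewrite /path_word /= subst_cat subst_nseq subst_cat subst_nseq /=.
have [gy|gy0] := eqVneq (g y) [::].
  move=> sub; have /negP[] := power_not_subword_B k2 gx0.
  apply: subword_infix sub; rewrite gy power_nil.
  have -> : power k.+1 (g x) = power k (g x) ++ g x.
    by rewrite /power -addn1 nseqD flatten_cat /= cats0.
  by rewrite /= catA; exact: prefix_infix.
case/subword_BP => [|zin].
  case: (g x) gx0 => // c u _ /(_ c).
  by rewrite !count_cat !count_power /= eqxx; nia.
have := size_infix zin; rewrite size_square_word !size_cat !size_power size_path_tail => sz.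
right; exists [::], x, y, s.
have gs : subst g s = [::].
  by case: (g x) gx0 sz => // ? ? _; case: (g y) gy0 => // ? ? _; case: (subst g s) => // ? ? /=; nia.
move: sz zin; rewrite path_tail_nil // gs.
case: (g x) gx0 => // c [|c' u] _; case: (g y) gy0 => // d [|d' v] _ /=; try nia.
move=> _ /infix_eq_size; rewrite size_square_word !size_cat !size_power /= !power1 => E.
have /eqP := E (ltac:(lia)).
by rewrite !eqseq_cat ?size_nseq //= => /and3P[_ _ /eqP[-> ->]].
Qed.

Section CyclicOperation.
Variables (k n : nat).
Hypotheses (k2 : 2 <= k) (n2 : 2 <= n).

Let S := M_B k.
Let cls := rees_class (words_B k).
Let nx : 'I_n -> 'I_n := next (enum 'I_n).

Definition edge_at (x : 'I_n -> S) (u v : 'I_n) :=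
  [/\ x u = cls [:: a], x v = cls [:: b] & forall j, j != u -> j != v -> x j = cls [::]].

(** The operation that a word would induce if each of its letters occurred k+1
    times and its restriction to x_i, x_j were x_i^k x_j^k x_i x_j exactly when
    j follows i on the cycle. *)
Definition cyclic_op (x : 'I_n -> S) : S :=
  if `[< forall i, x i = cls [::] >] then cls [::]
  else if `[< exists i, edge_at x i (nx i) >] then cls (square_word k)
  else None.

Lemma cls_nil u : cls u = cls [::] <-> u = [::].
Proof. by split=> [/esym/(rees_class_inj (subword_B_short _))->|->]. Qed.

Lemma cls_letter u c : cls u = cls [:: c] <-> u = [:: c].
Proof.
split=> [/esym|->//]; move/(rees_class_inj (subword_B_short _)) => -> //=; lia.
Qed.

(** What is left of the cycle without i is a path from the successor of i to its
    predecessor; with i at both ends, every arc of the cycle joins consecutive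
    letters. *)
Lemma cycle_cut i : exists l, [/\ uniq (i :: l), forall j, j != i -> j \in l &
  forall s1 u v s2, rcons (i :: l) i = s1 ++ u :: v :: s2 -> v = nx u].
Proof.
have [m l rotE] := rot_to (mem_enum 'I_n i).
have ul : uniq (i :: l) by rewrite -rotE rot_uniq enum_uniq.
exists l; split=> // [j ji|s1 u v s2 E].
  by have := mem_enum 'I_n j; rewrite -(mem_rot m) rotE !inE (negbTE ji).
have : fcycle nx (enum 'I_n) by apply: cycle_next; exact: enum_uniq.
rewrite -(rot_cycle m) rotE /=.
case: s1 E => [[<- E]|w s1 [_ E]]; first by rewrite E /= => /andP[/eqP].
by rewrite E cat_path /= => /and4P[_ _ /eqP].
Qed.

Lemma cyclic_op_edge x u : edge_at x u (nx u) -> cyclic_op x = cls (square_word k).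
Proof.
move=> xu; rewrite /cyclic_op; case: asboolP => [x1|_].
  by case: xu; rewrite x1 => /esym/cls_nil.
by case: asboolP => // - []; exists u.
Qed.

(** Setting x_i to 1 cuts the cycle at i, and the remaining path is realised by
    a word. *)
Lemma cyclic_op_cut i : exists l, forall g : 'I_n -> seq bool,
  g i = [::] -> cyclic_op (fun j => cls (g j)) = cls (subst g (path_word k l)).
Proof.
have [l [ul lmem lnx]] := cycle_cut i; exists l => g gi.
have [[u gu]|noedge] := pselect (exists u, edge_at (fun j => cls (g j)) u (nx u)).
  rewrite (cyclic_op_edge gu); case: gu => /cls_letter gu /cls_letter gv gw.
  have /splitPr lu : u \in l by apply: lmem; apply/eqP => ui; rewrite ui gi in gu.
  case: lu ul lmem lnx => s1 s2 ul lmem lnx.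
  have {}lnx v s' : rcons s2 i = v :: s' -> v = nx u.
    by move=> E; apply: (lnx (i :: s1) _ _ s'); rewrite /= rcons_cat /= E.
  case: s2 ul lmem lnx => [|v s2] ul lmem lnx.
    by have := lnx _ _ erefl => iE; rewrite -iE gi in gv.
  have vE : v = nx u by exact: lnx erefl.
  have {}gw j : j != u -> j != v -> g j = [::].
    by move=> ju jv; apply/cls_nil; apply: gw; rewrite -?vE.
  rewrite path_word_edge ?vE //; apply/subst_nil => j js; apply: gw; apply/eqP => jE;
    by move: ul; rewrite -jE /= cat_uniq /= !(mem_cat, inE) js ?eqxx ?orbT ?andbF.
have [sub|nsub] := boolP (subword (words_B k) (subst g (path_word k l))).
  case: (path_wordP k2 sub) => [/subst_nil gl|[s1 [u [v [s2 [lE gu gv /subst_nil gs]]]]]].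
    have g0 j : g j = [::] by have [->|/lmem/gl] := eqVneq j i.
    rewrite /cyclic_op asboolT => [|j]; last by rewrite g0.
    by congr (cls _); apply/esym/subst_nil.
  case: noedge; exists u.
  have <- : v = nx u by apply: (lnx (i :: s1) _ _ (rcons s2 i)); rewrite lE /= rcons_cat.
  split; rewrite ?gu ?gv // => j ju jv; congr (cls _).
  have [->|/lmem] := eqVneq j i; first by [].
  by rewrite lE mem_cat !inE (negbTE ju) (negbTE jv) -mem_cat => /gs.
rewrite [RHS]rees_class_zero // /cyclic_op asboolF => [|g1]; first by rewrite asboolF.
case/negP: nsub; have -> : subst g (path_word k l) = [::].
  by apply/subst_nil => j _; apply/cls_nil.
exact: subword_B_short.
Qed.

(** If x_i = x_j is not 1, it cannot be both a and b, so the operation is 0; the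
    factor x_i^(k+1) has the same effect. *)
Lemma cyclic_op_minor i j : i != j -> exists i0 w0, forall x : 'I_n -> S,
  x i = x j -> cyclic_op x = word_eval i0 w0 x.
Proof.
move=> ij; have [l lP] := cyclic_op_cut i.
exists i, (nseq k i ++ path_word k l) => x xij.
have [g gx] := choice (fun l => rees_class_surj (power_not_subword_B k2 (isT : [:: a] != [::])) (x l)).
have xE : x = fun l => cls (g l) by apply: funext => m; rewrite [RHS]gx.
rewrite {2}xE word_eval_rees_class -cat_cons subst_cat subst_nseqS.
have [gi|gi] := eqVneq (g i) [::].
  by rewrite xE lP // gi power_nil.
rewrite rees_class_zero; last first.
  apply: contra (power_not_subword_B k2 gi); apply: subword_infix; exact: prefix_infix.
have xi1 : x i <> cls [::] by rewrite -gx => /cls_nil; apply/eqP.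
rewrite /cyclic_op asboolF => [|/(_ i)//]; rewrite asboolF // => -[u [xu xv xw]].
have mem m : x m <> cls [::] -> m = u \/ m = nx u.
  move=> xm; have [->|mu] := eqVneq m u; first by left.
  by have [->|mv] := eqVneq m (nx u); [right | case: xm; exact: xw].
have ab : x u <> x (nx u) by rewrite xu xv => /esym/cls_letter.
have [iE|iE] := mem i xi1; have [jE|jE] := mem j (fun H => xi1 (etrans xij H));
  by move: ij xij ab; rewrite iE jE ?eqxx // => _ ->.
Qed.

(** If x_i is the first letter of a word that induces the operation, and j is
    the predecessor of i, then the value at x_j = a, x_i = b, and 1 elsewhere
    would have to begin with b. *)
Lemma cyclic_op_not_term : ~ term_function cyclic_op.
Proof.
case=> i [w wE]; pose j := prev (enum 'I_n) i.
have ji : nx j = i by apply: next_prev; exact: enum_uniq.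
have neq : j != i.
  apply/eqP => jE; have [l [/= /andP[il _] lmem lnx]] := cycle_cut i.
  case: l il lmem lnx => [|v l] il lmem lnx.
    have all_i m : m = i by apply/eqP/contraT => /lmem.
    by have /(congr1 val) := etrans (all_i (Ordinal (ltnW n2))) (esym (all_i (Ordinal n2))).
  have vE : v = nx i by apply: (lnx [::] _ _ (rcons l i)).
  by move: il; rewrite vE -[in X in nx X]jE ji mem_head.
pose g m := if m == j then [:: a] else if m == i then [:: b] else [::].
have := wE (fun m => cls (g m)); rewrite (@cyclic_op_edge _ j); last first.
  rewrite ji /edge_at /g eqxx eq_sym (negbTE neq) eqxx; split=> // m.
  by move=> /negbTE-> /negbTE->.
rewrite word_eval_rees_class => /(rees_class_inj (square_wordB k))/(congr1 (nth b ^~ 0)).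
rewrite /= {1}/g eq_sym (negbTE neq) eqxx /= /square_word nth_cat nth_nseq size_nseq.
by rewrite (_ : 0 < k) //; lia.
Qed.

End CyclicOperation.

Lemma M_B_not_finitely_related k : 2 <= k -> ~ finitely_related (M_B k).
Proof.
move=> k2; have [s sP] : exists s : seq (M_B k), forall x, x \in s.
  apply: (@rees_finite _ k.*2.+2) => u su.
  rewrite size_count_bool; have := subword_B_count a su; have := subword_B_count b su; lia.
apply: (not_finitely_related sP) => n n2; exists (@cyclic_op k n).
  exact: cyclic_op_not_term.
by move=> i j; exact: cyclic_op_minor.
Qed.

(** * Words as operations on M(A_k) *)

Lemma rees_class_A_nil k u : rees_class (words_A k) u = rees_class (words_A k) [::] -> u = [::].
Proof. by move/esym/rees_class_inj => <- //; apply/subword_AP. Qed.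

Lemma rees_class_A_long k (u : seq bool) : k.*2 < size u -> rees_class (words_A k) u = None.
Proof.
move=> ku; apply: rees_class_zero; apply/negP => /subword_AP cu.
by have := cu a; have := cu b; rewrite size_count_bool in ku; lia.
Qed.

Lemma rees_class_A_heavy k (T : eqType) (g : T -> seq bool) i w :
  g i != [::] -> k < count_mem i w -> rees_class (words_A k) (subst g w) = None.
Proof.
case gi : (g i) => [|c u] // _ ki; apply: rees_class_zero; apply/negP => /subword_AP /(_ c).
by have := count_subst_ge g c i w; rewrite gi /= eqxx; nia.
Qed.

(** A letter that occurs more than k times sends the word to 0 or has value 1,
    so only the pairs of letters that occur at most k times matter. *)
Lemma eq_rees_class_A k (T : eqType) (g : T -> seq bool) w v :
  (forall i, g i != [::] ->
     minn k.+1 (count_mem i w) = minn k.+1 (count_mem i v)) ->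
  (forall i j, g i != [::] -> g j != [::] ->
     count_mem i w <= k -> count_mem j w <= k ->
     filter (pred2 i j) w = filter (pred2 i j) v) ->
  rees_class (words_A k) (subst g w) = rees_class (words_A k) (subst g v).
Proof.
move=> cnt prs.
have [[i [gi ki]]|light] := pselect (exists i, g i != [::] /\ k < count_mem i w).
  rewrite (rees_class_A_heavy gi ki) (rees_class_A_heavy gi) //; have := cnt i gi; lia.
rewrite -[subst g w]subst_filter -[subst g v]subst_filter; congr (rees_class _ (subst g _)).
have {}light i : g i != [::] -> count_mem i w <= k.
  by move=> gi; rewrite leqNgt; apply/negP => ki; apply: light; exists i.
by apply: eq_filter_from_pairs => i j gi gj; apply: prs => //; apply: light.
Qed.

Lemma rees_class_A_nseq k m n :
  rees_class (words_A k) (nseq m a) = rees_class (words_A k) (nseq n a) ->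
  minn k.+1 m = minn k.+1 n.
Proof.
have sub l : l <= k -> subword (words_A k) (nseq l a).
  by move=> lk; apply/subword_AP => c; apply: leq_trans (count_size _ _) _; rewrite size_nseq.
have [mk|km] := leqP m k; first by move/(rees_class_inj (sub m mk))/(congr1 size); rewrite !size_nseq => ->.
have [nk|kn] := leqP n k; last by lia.
by move/esym/(rees_class_inj (sub n nk))/(congr1 size); rewrite !size_nseq => ->.
Qed.

(** Conversely, the occurrences of two letters can be read off from the
    operation, at x_i = a and x_j = b. *)
Lemma rees_class_A_pair k (T : eqType) (i j : T) w v :
  (forall g : T -> seq bool, (forall l, l != i -> l != j -> g l = [::]) ->
     rees_class (words_A k) (subst g w) = rees_class (words_A k) (subst g v)) ->
  minn k.+1 (count_mem i w) = minn k.+1 (count_mem i v) /\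
  (count_mem i w <= k -> count_mem j w <= k ->
   filter (pred2 i j) w = filter (pred2 i j) v).
Proof.
move=> E; have cnt : minn k.+1 (count_mem i w) = minn k.+1 (count_mem i v).
  apply: rees_class_A_nseq; rewrite -!subst_delta; apply: E => l li _.
  by rewrite /delta (negbTE li).
split=> // ik jk; have [<-|ij] := eqVneq i j.
  by rewrite !filter_pred2_diag; congr nseq; lia.
pose g l := if l == i then [:: a] else if l == j then [:: b] else [::].
have gK u : [seq (if c then j else i) | c <- subst g u] = filter (pred2 i j) u.
  elim: u => //= l u <-; rewrite map_cat /g.
  case: (eqVneq l i) => [->|_] //=.
  by case: (eqVneq l j) => [->|_].
rewrite -!gK; congr map; apply: rees_class_inj (E g _) => [|l /negbTE li /negbTE lj]; last first.
  by rewrite /g li lj.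
apply/subword_AP; suff cE c : count_mem c (subst g w) = count_mem (if c then j else i) w.
  by case=> //; rewrite cE.
elim: w {E cnt ik jk} => //= l u IH; rewrite count_cat IH /g; congr addn.
case: c {IH} => /=.
  by case: (eqVneq l i) => [->|_] /=; [rewrite (negbTE ij)|case: (l == j)].
by case: (l == i); case: (l == j).
Qed.

(** * M(A_k) is finitely related *)

(** The operation f is only known to become a term when its variables are
    identified so that few of them remain.  The number k.*2 + 3 leaves room for
    more variables than a surviving word has letters, and for at least three;
    the number of elements of M(A_k) leaves room for identifying the other
    variables according to their values. *)
Section LocalTerm.
Variables (k n : nat) (f : ('I_n -> M_A k) -> M_A k) (s : seq (M_A k)).
Let cls := rees_class (words_A k).
Hypothesis sP : forall x, x \in s.
Hypothesis minor_term : forall (X : eqType) (sigma : 'I_n -> X),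
  size (undup (map sigma (enum 'I_n))) <= k.*2 + 3 + size s ->
  exists2 w : seq X, w != [::] &
    forall g : X -> seq bool, f (fun i => cls (g (sigma i))) = cls (subst g w).

Lemma size_image (X : eqType) (sigma : 'I_n -> X) (D : seq X) :
  (forall i, sigma i \in D) -> size (undup (map sigma (enum 'I_n))) <= size D.
Proof.
move=> sD; apply: uniq_leq_size (undup_uniq _) _ => x.
by rewrite mem_undup => /mapP[i _ ->].
Qed.

(** The variable x_i cannot occur in a word that induces f. *)
Definition absent i := f (fun j => cls (delta i a j)) = cls [::].

(** A single variable that stands for many absent variables is absent too: by
    induction on their number, since splitting it into two variables gives a
    word in which neither part occurs. *)
Lemma absent_block (B : seq 'I_n) : (forall i, i \in B -> absent i) ->
  f (fun i => cls (if i \in B then [:: a] else [::])) = cls [::].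
Proof.
elim: B => [|j B IH] BP.
  have [|w _ wE] := @minor_term unit (fun=> tt).
    by apply: leq_trans (@size_image _ _ [:: tt] _) _ => //=; lia.
  have -> := wE (fun=> [::]); congr cls.
  by apply/subst_nil.
have {}IH := IH (fun i iB => BP i (mem_behead (s := j :: B) iB)).
have [jB|jB] := boolP (j \in B).
  rewrite -IH; congr f; apply: funext => i; rewrite inE.
  by case: eqP => // ->; rewrite jB.
pose sigma i := if i == j then Some true else if i \in B then Some false else None.
have [|w _ wE] := @minor_term _ sigma.
  apply: leq_trans (@size_image _ _ [:: Some true; Some false; None] _) _ => [i|/=]; last lia.
  by rewrite /sigma; case: ifP => // _; case: ifP.
have c1 : count_mem (Some true) w = 0.
  have : cls (nseq (count_mem (Some true) w) a) = cls [::].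
    rewrite -subst_delta -wE -(BP j (mem_head _ _)); congr f; apply: funext => i.
    by rewrite /delta /sigma; case: (i == j) => //; case: (i \in B).
  by move/rees_class_A_nil; case: count.
have c2 : count_mem (Some false) w = 0.
  have : cls (nseq (count_mem (Some false) w) a) = cls [::].
    rewrite -subst_delta -wE -IH; congr f; apply: funext => i.
    rewrite /delta /sigma; case: (eqVneq i j) => [->|_]; first by rewrite (negbTE jB).
    by case: (i \in B).
  by move/rees_class_A_nil; case: count.
pose g (o : option bool) : seq bool := if o is Some _ then [:: a] else [::].
have g0 : subst g w = [::].
  apply/subst_nil => -[c|] // cw.
  by move: (cw); rewrite -has_pred1 has_count; case: c cw => _; rewrite ?c1 ?c2.
rewrite -[in RHS]g0 -wE; congr f; apply: funext => i; rewrite inE /sigma.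
by case: (i == j) => //=; case: (i \in B).
Qed.

(** The variables in D are kept and the others are identified according to
    their values, which gives a word over ['I_n + M_A k]; w consists of its
    letters that are kept.  Forgetting the other letters can only turn a 0
    into a nonzero value, and changes nothing if these letters have value 1
    or stand for absent variables, for then they do not occur. *)
Lemma localize (y : 'I_n -> seq bool) (D : seq 'I_n) : size D <= k.*2 + 3 ->
  let yD i := if i \in D then y i else [::] in
  exists w, [/\
    forall g, (forall i, i \notin D -> g i = [::]) ->
      f (fun i => cls (g i)) = cls (subst g w),
    cls (subst yD w) = None -> f (fun i => cls (y i)) = None &
    (forall i, i \notin D -> y i = [::] \/ absent i) ->
      f (fun i => cls (y i)) = cls (subst yD w)].
Proof.
move=> sD yD.
have [rep repK] := choice (rees_class_surj (power_not_subword_A k (isT : [:: a] != [::]))).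
pose sigma i : 'I_n + M_A k := if i \in D then inl i else inr (cls (y i)).
have [|w0 _ wE] := @minor_term _ sigma.
  apply: leq_trans (@size_image _ _ (map inl D ++ map inr s) _) _ => [i|].
    rewrite /sigma mem_cat; case: ifP => iD; first by rewrite map_f.
    by rewrite [X in _ || X]map_f ?orbT.
  by rewrite size_cat !size_map leq_add2r.
pose w := pmap (fun z : 'I_n + M_A k => if z is inl i then Some i else None) w0.
(* onD g forgets the identified letters, Y evaluates all letters *)
pose onD (g : 'I_n -> seq bool) (z : 'I_n + M_A k) := if z is inl i then g i else [::].
pose Y (z : 'I_n + M_A k) := if z is inr t then rep t else onD yD z.
have wsub g : subst (onD g) w0 = subst g w.
  by rewrite /w; elim: (w0) => //= -[i|t] v ->.
have yE : f (fun i => cls (y i)) = cls (subst Y w0).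
  rewrite -wE; congr f; apply: funext => i; rewrite /sigma /Y /yD.
  by case iD: (i \in D); rewrite /= ?iD ?[RHS]repK.
exists w; split=> [g gD||yD0].
- rewrite -wsub -wE; congr f; apply: funext => i.
  by rewrite /sigma; case: ifPn => // /gD ->.
- rewrite yE -wsub => E; apply: rees_class_zero; apply/negP => /subword_AP sw.
  have /subword_AP sv : words_A k (subst (onD yD) w0).
    move=> c; apply: leq_trans (sw c).
    by elim: (w0) => //= -[i|t] v IH; rewrite !count_cat /= leq_add.
  by move: E; rewrite /cls /rees_class insubT.
rewrite yE -wsub; congr (cls (flatten _)); apply/eq_in_map => -[i|t] // tw.
have [->|t1] := eqVneq t (cls [::]); first by exact: rees_class_A_nil (repK _).
have : cls (subst (delta (inr t) a) w0) = cls [::].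
  rewrite -wE -[RHS](@absent_block [seq i <- enum 'I_n | (i \notin D) && (cls (y i) == t)]).
    congr f; apply: funext => i; rewrite mem_filter mem_enum andbT /delta /sigma.
    by case: (i \in D).
  move=> i; rewrite mem_filter => /andP[/andP[/yD0 [y0|//] /eqP yt] _].
  by rewrite -yt y0 eqxx in t1.
rewrite subst_delta => /rees_class_A_nil E; move: tw; rewrite -has_pred1 has_count.
by case: count E.
Qed.

Definition agrees (D w : seq 'I_n) := forall g : 'I_n -> seq bool,
  (forall i, i \notin D -> g i = [::]) -> f (fun i => cls (g i)) = cls (subst g w).

Lemma agrees_sep D D' w v i j : agrees D w -> agrees D' v ->
  i \in D -> j \in D -> i \in D' -> j \in D' ->
  minn k.+1 (count_mem i w) = minn k.+1 (count_mem i v) /\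
  (count_mem i w <= k -> count_mem j w <= k ->
   filter (pred2 i j) w = filter (pred2 i j) v).
Proof.
move=> Dw D'v iD jD iD' jD'; apply: rees_class_A_pair => g g0.
have supp (E : seq 'I_n) : i \in E -> j \in E -> forall l, l \notin E -> g l = [::].
  by move=> iE jE l lE; apply: g0; apply: contraNneq lE => ->.
by rewrite -[LHS](Dw g (supp D iD jD)) -[RHS](D'v g (supp D' iD' jD')).
Qed.

(** The words given by pairs of variables are consistent because of the words
    given by triples, and glue to a word in the variables that occur at most k
    times.  Appending the other variables k+1 times each makes the operation
    vanish exactly where f does because of them. *)
Lemma pair_agreement : exists u, forall i j, agrees [:: i; j] u.
Proof.
have Wex D : exists w, size D <= 3 -> agrees D w.
  have [D3|_] := boolP (size D <= 3); last by exists [::].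
  have [|w [wD _ _]] := @localize (fun=> [::]) D; first by lia.
  by exists w.
have [W WP] := choice Wex.
pose rare i := count_mem i (W [:: i]) <= k.
pose p i j := filter (pred2 i j) (filter rare (W [:: i; j])).
have cnt D i : size D <= 3 -> i \in D ->
    minn k.+1 (count_mem i (W D)) = minn k.+1 (count_mem i (W [:: i])).
  move=> D3 iD.
  by have [] := agrees_sep (WP D D3) (WP [:: i] isT) iD iD (mem_head _ _) (mem_head _ _).
have rareE D i : size D <= 3 -> i \in D -> rare i = (count_mem i (W D) <= k).
  by move=> D3 iD; have := cnt D i D3 iD; rewrite /rare; lia.
have pE D i j : size D <= 3 -> i \in D -> j \in D ->
    filter (pred2 i j) (filter rare (W D)) = p i j.
  move=> D3 iD jD.
  have i2 : i \in [:: i; j] by rewrite mem_head.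
  have j2 : j \in [:: i; j] by rewrite !inE eqxx orbT.
  have eqf x y : x \in D -> y \in D -> x \in [:: i; j] -> y \in [:: i; j] ->
      rare x -> rare y -> filter (pred2 x y) (W D) = filter (pred2 x y) (W [:: i; j]).
    move=> xD yD x2 y2; rewrite (rareE D x) // (rareE D y) //.
    by have [_] := agrees_sep (WP D D3) (WP [:: i; j] isT) xD yD x2 y2.
  rewrite /p !filter_pred2_filter.
  by case: ifP => ri; case: ifP => rj //; apply: eqf.
have [u uP] : exists u, forall i j, filter (pred2 i j) u = p i j.
  apply: amalgamation => r q t; exists (filter rare (W [:: r; q; t])).
  by split; apply: pE; rewrite // !inE eqxx ?orbT.
exists (u ++ flatten [seq nseq k.+1 i | i <- enum 'I_n & ~~ rare i]).
set h := flatten _.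
have hrare i j : rare i -> rare j -> filter (pred2 i j) h = [::].
  move=> ri rj; apply/eqP; rewrite -(negbK (_ == _)) -has_filter; apply/hasPn => l.
  case/flatten_mapP => m; rewrite mem_filter => /andP[rm _] /nseqP[-> _] /=.
  by apply/norP; split; apply: contraNneq rm => ->.
have hheavy i : ~~ rare i -> k < count_mem i h.
  rewrite /h => ri; have : i \in [seq i <- enum 'I_n | ~~ rare i] by rewrite mem_filter ri mem_enum.
  elim: [seq _ <- _ | _] => //= m l IH; rewrite inE count_cat -/(nseq k.+1 m) count_nseq.
  by case/predU1P => [->|/IH]; rewrite /= ?eqxx; lia.
move=> i j g g0.
have {}g0 l : g l != [::] -> l \in [:: i; j] by apply: contraR => /g0/eqP.
have D3 : size [:: i; j] <= 3 by [].
rewrite (WP [:: i; j]) // => [|l]; last by apply: contraNeq; exact: g0.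
apply: eq_rees_class_A => [l /g0 lD|l m /g0 lD /g0 mD].
  rewrite (cnt [:: i; j] l) // count_cat; have [rl|nl] := boolP (rare l); last first.
    by have := hheavy l nl; move: nl; rewrite /rare; lia.
  have := uP l l; rewrite filter_pred2_diag /p filter_pred2_filter rl filter_pred2_diag.
  have := hrare l l rl rl; rewrite filter_pred2_diag.
  move=> /(congr1 size) /= h0 /(congr1 size); rewrite !size_nseq in h0 * => ->.
  by rewrite h0 addn0 -!(cnt [:: l; l]) ?mem_head.
rewrite -!rareE // => rl rm.
rewrite filter_cat hrare // cats0 uP -(pE [:: i; j]) // filter_pred2_filter.
by rewrite rl rm.
Qed.

(** The word that agrees with f when at most two variables are not 1 induces f
    everywhere: both are compared with the word that [localize] provides for a
    bounded set D of variables, with which u agrees on D because it does so on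
    pairs. *)
Lemma local_term_function : 0 < n -> term_function f.
Proof.
move=> n0; have [u uP] := pair_agreement.
have absentP i : i \notin u -> absent i.
  move=> iu; rewrite /absent (uP i i) ?subst_delta ?(count_memPn iu) // => l.
  by rewrite /delta !inE orbb => /negbTE->.
(* a word must be nonempty to induce a term function *)
have u0 : u != [::].
  apply/eqP => uE; have [|w w0 wE] := @minor_term unit (fun=> tt).
    by apply: leq_trans (@size_image _ _ [:: tt] _) _ => //=; lia.
  have abs i : absent i by apply: absentP; rewrite uE.
  have := @absent_block (enum 'I_n) (fun i _ => abs i).
  rewrite (_ : (fun i => _) = fun i : 'I_n => cls ((fun=> [:: a]) tt)).
    rewrite (wE (fun=> [:: a])) => /rees_class_A_nil.
    by case: (w) w0.
  by apply: funext => i; rewrite mem_enum.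
case: u u0 uP absentP => // i0 w0 _; set u := i0 :: w0 => uP absentP.
exists i0, w0 => x.
have [y yx] := choice (fun i => rees_class_surj (power_not_subword_A k (isT : [:: a] != [::])) (x i)).
have -> : x = fun i => cls (y i) by apply: funext => i; rewrite [RHS]yx.
rewrite word_eval_rees_class -/u.
(* the variables of u with a value other than 1, and a bounded part of them *)
pose E := undup [seq i <- u | y i != [::]].
have EP i : i \in E = (y i != [::]) && (i \in u) by rewrite mem_undup mem_filter.
pose D := take (k.*2 + 3) E.
have sD : size D <= k.*2 + 3 by rewrite size_take; case: ltnP; lia.
have [w [wD wzero wE]] := localize y sD.
set yD := (fun i => if i \in D then y i else [::]) in wzero wE.
have yDD i : yD i != [::] -> i \in D by rewrite /yD; case: ifP.
have wu : cls (subst yD w) = cls (subst yD u).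
  apply: eq_rees_class_A => [i /yDD iD|i j /yDD iD /yDD jD].
    by have [] := agrees_sep wD (uP i i) iD iD (mem_head _ _) (mem_head _ _).
  have [|] := agrees_sep wD (uP i j) iD jD (mem_head _ _) => //.
  by rewrite !inE eqxx orbT.
have [small|large] := leqP (size E) (k.*2 + 3).
  have DE : D = E by rewrite /D take_oversize.
  rewrite wE ?wu => [|i]; last first.
    rewrite DE EP negb_and negbK => /orP[/eqP|/absentP]; [by left|by right].
  congr (cls (flatten _)); apply/eq_in_map => i iu.
  by rewrite /yD DE EP iu andbT; case: eqP.
(* more letters are kept than a surviving word has, so both values are 0 *)
have sDE : size D = k.*2 + 3 by rewrite size_take large.
have uD : uniq D by apply: take_uniq; exact: undup_uniq.
have DE i : i \in D -> y i != [::] /\ i \in u.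
  by move=> /mem_take; rewrite EP => /andP[].
rewrite wzero; last first.
  rewrite wu; apply: rees_class_A_long; apply: leq_trans (size_subst_ge (D := D) uD _); first by rewrite sDE; lia.
  by move=> i iD; have [yi iu] := DE i iD; rewrite /yD iD.
apply/esym/rees_class_A_long; apply: leq_trans (size_subst_ge (D := D) uD _); first by rewrite sDE; lia.
by move=> i /DE[].
Qed.

End LocalTerm.

(** The relation consists of the value tuples of the N-ary term functions.
    Applying f to tuples that come from single variables gives its minors, so
    these are terms when f preserves the relation. *)
Lemma M_A_finitely_related k : finitely_related (M_A k).
Proof.
have [s sP] : exists s : seq (M_A k), forall x, x \in s.
  apply: (@rees_finite _ k.*2) => u /subword_AP su.
  by rewrite size_count_bool; have := su a; have := su b; lia.
pose N := k.*2 + 3 + size s.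
(* every evaluation of N variables is a coordinate of the relation *)
pose point (l : 'I_#|{ffun 'I_N -> 'I_(size s)}|) (t : 'I_N) : M_A k :=
  nth None s (enum_val l t).
have pointP (y : 'I_N -> M_A k) : exists l, point l = y.
  have lt_index t : index (y t) s < size s by rewrite index_mem.
  exists (enum_rank [ffun t => Ordinal (lt_index t)]); apply: funext => t.
  by rewrite /point enum_rankK ffunE /= nth_index.
pose R : set ('I_#|{ffun 'I_N -> 'I_(size s)}| -> M_A k) :=
  [set r | exists i w, forall l, r l = word_eval i w (point l)]%classic.
exists 1, (fun=> _), (fun=> R) => n f n0; split=> [fR|[i [w fE]] _ r rR]; last first.
  have [i' ri] := choice rR; have [w' rw] := choice ri.
  have [j [v vE]] := word_eval_comp (M_A k) i w i' w'.
  exists j, v => l; rewrite fE -vE; congr (word_eval _ _ _).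
  by apply: funext => t; rewrite rw.
apply: (local_term_function sP _ n0) => X sigma sz.
(* the distinct values of sigma become N variables *)
pose im := undup (map sigma (enum 'I_n)).
have im_in i : sigma i \in im by rewrite mem_undup map_f ?mem_enum.
have lt_index i : index (sigma i) im < N by apply: leq_trans sz; rewrite index_mem.
pose tau i := Ordinal (lt_index i).
have [|i [w fw]] := fR ord0 (fun i l => point l (tau i)).
  by move=> i; exists (tau i), [::].
pose x0 := sigma (Ordinal n0).
exists [seq nth x0 im (val t) | t <- i :: w] => // g.
have [l lE] := pointP (fun t => rees_class (words_A k) (g (nth x0 im t))).
have := fw l; rewrite lE word_eval_rees_class -map_comp => <-.
by congr f; apply: funext => t; rewrite /= nth_index.
Qed.

Theorem corollary4p8 (k : nat) (hk : (2 <= k)%N) :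
  [/\ strict_subclass (variety_of (M_A k)) (variety_of (M_B k)),
      strict_subclass (variety_of (M_B k)) (variety_of (M_A k.+1)),
      finitely_related (M_A k) &
      ~ finitely_related (M_B k)].
Proof.
split.
- exact: variety_A_strict_B.
- exact: variety_B_strict_A.
- exact: M_A_finitely_related.
- exact: M_B_not_finitely_related.
Qed.
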